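(* Let $K$ be a field, $S=K[x_1,\ldots,x_n]$, $\mathfrak m=(x_1,\ldots,x_n)$, and let $I\subset S$ be a monomial ideal with componentwise linear quotients. Suppose that for each component $I_{\langle a\rangle}$ there exists an admissible order $\sigma_a$ of $G(I_{\langle a\rangle})$ with the property that the elements of $G(\mathfrak m I_{\langle a-1\rangle})$ form the initial part of $\sigma_a$ (i.e. all elements of $G(\mathfrak m I_{\langle a-1\rangle})$ come in $\sigma_a$ before all other elements of $G(I_{\langle a\rangle})$). Then $I$ has linear quotients.
   Context: For a monomial ideal $I$, $G(I)$ denotes its unique minimal set of monomial generators. An ordering $u_1,\ldots,u_m$ of $G(I)$ is called an admissible order if for each $i=2,\ldots,m$ the colon ideal $(u_1,\ldots,u_{i-1}):u_i$ is generated by a subset of the variables $\{x_1,\ldots,x_n\}$. $I$ has linear quotients if $G(I)$ has an admissible order (the zero ideal has linear quotients vacuously). $I_{\langle a\rangle}$ denotes the ideal of $S$ generated by the degree-$a$ graded component of $I$. $I$ has componentwise linear quotients if $I_{\langle a\rangle}$ has linear quotients for every $a$. *)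

(* Defs.v *)
From mathcomp Require Import all_boot all_order all_algebra.
From mathcomp Require Import classical_sets.
From mathcomp Require Import mpoly.

Set Implicit Arguments.
Unset Strict Implicit.
Unset Printing Implicit Defensive.

Import GRing.Theory.

Local Open Scope classical_set_scope.
Local Open Scope ring_scope.

Section Ideals.
Variable R : comNzRingType.

(* MathComp's idealr_closed excludes the unit ideal, hence this definition. *)
Definition is_ideal (I : set R) : Prop :=
  [/\ I 0,
      forall f g, I f -> I g -> I (f + g)
    & forall h f, I f -> I (h * f)].

Definition ideal_gen (A : set R) : set R := smallest is_ideal A.

Definition ideal_mul (I J : set R) : set R :=
  ideal_gen [set h | exists f g, [/\ I f, J g & h = f * g]].

Definition colon (I : set R) (f : R) : set R := [set g | I (g * f)].

End Ideals.

Section MonomialIdeals.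
Variables (K : fieldType) (n : nat).

Definition mon_ideal (U : set 'X_{1..n}) : set {mpoly K[n]} :=
  ideal_gen [set 'X_[K, u] | u in U].

Definition is_monomial_ideal (I : set {mpoly K[n]}) : Prop :=
  exists U : set 'X_{1..n}, I = mon_ideal U.

(* U = G(I): monomials are represented by their exponent vectors, and
   minimality is with respect to inclusion. *)
Definition is_mingens (I : set {mpoly K[n]}) (U : set 'X_{1..n}) : Prop :=
  I = mon_ideal U /\
  forall V : set 'X_{1..n}, V `<=` U -> I = mon_ideal V -> V = U.

Definition var_ideal (A : {set 'I_n}) : set {mpoly K[n]} :=
  ideal_gen [set f | exists2 i, i \in A & f = 'X_i].

Definition max_ideal : set {mpoly K[n]} := var_ideal [set: 'I_n].

(* s is indexed from 0, so 0 < i corresponds to i = 2, ..., m. *)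
Definition admissible_order (I : set {mpoly K[n]}) (s : seq 'X_{1..n}) : Prop :=
  [/\ uniq s,
      is_mingens I [set u | u \in s]
    & forall i, (0 < i < size s)%N ->
        exists A : {set 'I_n},
          colon (mon_ideal [set u | u \in take i s]) 'X_[K, nth 0%MM s i]
          = var_ideal A].

Definition has_linear_quotients (I : set {mpoly K[n]}) : Prop :=
  exists s, admissible_order I s.

Definition component (I : set {mpoly K[n]}) (d : nat) : set {mpoly K[n]} :=
  ideal_gen [set f | I f /\ f \is d.-homog].

Definition componentwise_linear_quotients (I : set {mpoly K[n]}) : Prop :=
  forall a, has_linear_quotients (component I a).

Definition initial_mingens (J : set {mpoly K[n]}) (s : seq 'X_{1..n}) : Prop :=
  exists s1 s2, s = s1 ++ s2 /\ is_mingens J [set u | u \in s1].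

End MonomialIdeals.

Arguments max_ideal : clear implicits.

(* Main.v *)
(* A monomial ideal is determined by the upward closed set of its exponents, so
   all conditions become combinatorial.  Each admissible order of G(I_<d>)
   splits as sigma1 d ++ sigma2 d with sigma1 d = G(m I_<d-1>), and sigma2 d is
   then G(I)_d.  Concatenating sigma2 0, sigma2 1, ... up to the largest degree
   of a generator (which exists by Dickson's lemma) gives an admissible order
   of G(I): a multiple of degree at least d of a generator of degree < d is a
   multiple of an element of sigma1 d, and conversely each element of sigma1 d
   is a multiple of such a generator.  Hence replacing sigma1 d by G(I)_{<d} in
   front of sigma2 d does not change the colon ideals. *)

Require Import Defs.
From mathcomp Require Import all_boot all_order all_algebra.
From mathcomp Require Import boolp classical_sets.
From mathcomp Require Import mpoly.

Set Implicit Arguments.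
Unset Strict Implicit.
Unset Printing Implicit Defensive.

Import GRing.Theory.

Section MonomialIdealTheory.
Variables (K : fieldType) (n : nat).
Implicit Types (I : set {mpoly K[n]}) (U V : set 'X_{1..n}).
Implicit Types (u v w m t : 'X_{1..n}) (i : 'I_n).

(** * Divisibility of exponent vectors *)

Lemma lepm_mdeg u v : (u <= v)%MM -> mdeg u <= mdeg v.
Proof. by move=> /submK <-; rewrite mdegD leq_addl. Qed.

Lemma lepm_mdeg_eq u v : (u <= v)%MM -> mdeg v <= mdeg u -> u = v.
Proof.
move=> /submK <-; rewrite mdegD -[leqRHS]add0n leq_add2r leqn0 mdeg_eq0.
by move=> /eqP ->; rewrite add0m.
Qed.

(** A variable dividing the quotient [v - u] can be split off from [v] without losing divisibility
    by [u]. This is how membership in [m I] is recognized later. *)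
Lemma lepm_proper u v : (u <= v)%MM -> u <> v ->
  exists i w, v = (U_(i) + w)%MM /\ (u <= w)%MM.
Proof.
move=> uv neq; have [i Hi] : exists i, (v - u)%MM i != 0%N.
  apply/existsP; apply: contra_notT neq => /existsPn h.
  apply/mnmP => i; have /negPn/eqP := h i; rewrite mnmBE => /eqP.
  by rewrite subn_eq0 => le_vu; apply/eqP; rewrite eqn_leq le_vu (mnm_lepP uv).
exists i, (v - u - U_(i) + u)%MM; split; last exact: lem_addl.
apply/mnmP => j; move: (mnm_lepP uv j) Hi.
rewrite !(mnmDE, mnmBE, mnm1E); case: (eqVneq i j) => [<-|_] /= le_uv; last first.
  by rewrite subn0 add0n subnK.
by rewrite -lt0n => gt0; rewrite addnA subnKC // subnK.
Qed.

(** * Membership in monomial ideals and their colon ideals *)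

Lemma ideal_gen_sub (R : comNzRingType) (A J : set R) :
  is_ideal J -> (A `<=` J)%classic -> (ideal_gen A `<=` J)%classic.
Proof. by move=> idJ AJ; exact: smallest_sub. Qed.

Lemma sub_ideal_gen (R : comNzRingType) (A : set R) : (A `<=` ideal_gen A)%classic.
Proof. exact: sub_smallest. Qed.

Lemma ideal_gen_ideal (R : comNzRingType) (A : set R) : is_ideal (ideal_gen A).
Proof.
split=> [J [[] //]|f g If Ig J JP|h f If J JP].
- by have [[_ addJ _] _] := JP; apply: addJ; [exact: If | exact: Ig].
- by have [[_ _ mulJ] _] := JP; apply: mulJ; exact: If.
Qed.

(** Polynomials supported on multiples of [U] form an ideal containing the generators; conversely
    each term of such a polynomial is a multiple of a generator. *)
Lemma mon_idealP U (f : {mpoly K[n]}) :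
  mon_ideal (K := K) U f <->
  forall m, m \in msupp f -> exists2 u, U u & (u <= m)%MM.
Proof.
split.
  apply: (@ideal_gen_sub _ _ [set g : {mpoly K[n]} |
    forall m, m \in msupp g -> exists2 u, U u & (u <= m)%MM]%classic).
    split=> [m|g h Hg Hh m|h g Hg m] /=; first by rewrite msupp0.
    - by move/msuppD_le; rewrite mem_cat => /orP[/Hg|/Hh].
    - move/msuppM_le/allpairsP => [[m1 m2] /= [_ /Hg [u Uu le] ->]].
      by exists u => //; exact: lepm_trans le (lem_addl _ _).
  by move=> _ [u Uu <-] m; rewrite msuppX inE => /eqP ->; exists u => //; exact: lepm_refl.
have [J0 JD JM] := ideal_gen_ideal [set 'X_[K, u] | u in U]%classic.
move=> H; rewrite [f]mpolyE big_seq.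
apply: (big_ind (mon_ideal (K := K) U)) => [||m]; [exact: J0 | exact: JD |].
move=> /H [u Uu /submK <-].
rewrite mpolyXD -mul_mpolyC mulrA; apply: (JM); apply: sub_ideal_gen.
by exists u.
Qed.

Lemma mon_idealXP U m :
  mon_ideal (K := K) U 'X_[m] <-> exists2 u, U u & (u <= m)%MM.
Proof.
rewrite mon_idealP; split=> [H|H m']; first by apply: H; rewrite msuppX inE.
by rewrite msuppX inE => /eqP ->.
Qed.

Lemma eq_mon_ideal U V :
  (forall m, (exists2 u, U u & (u <= m)%MM) <-> (exists2 v, V v & (v <= m)%MM)) ->
  mon_ideal (K := K) U = mon_ideal (K := K) V.
Proof.
by move=> UV; apply/predeqP => f; rewrite !mon_idealP;
  split=> H m /H /UV.
Qed.

Lemma var_idealE (A : {set 'I_n}) :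
  var_ideal (K := K) A = mon_ideal (K := K) [set U_(i)%MM | i in [set i | i \in A]]%classic.
Proof.
congr (ideal_gen _); apply/predeqP => f; split.
  by case=> i iA ->; exists U_(i)%MM => //; exists i.
by case=> _ [i iA <-] <-; exists i.
Qed.

(** The colon condition tested on monomials only; [colon_var_idealP] shows that this suffices. *)
Definition var_colon (s : seq 'X_{1..n}) u (A : {set 'I_n}) : Prop :=
  forall w, (exists2 v, v \in s & (v <= w + u)%MM) <-> (exists2 i, i \in A & 0 < w i).

(** Multiplication by ['X_[u]] shifts the support by [u], and membership in both ideals is decided
    term by term. *)
Lemma colon_var_idealP (s : seq 'X_{1..n}) u (A : {set 'I_n}) :
  colon (mon_ideal (K := K) [set v | v \in s]%classic) 'X_[K, u] = var_ideal (K := K) A <->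
  var_colon s u A.
Proof.
have varE w : (exists2 v, [set U_(i)%MM | i in [set i | i \in A]]%classic v & (v <= w)%MM)
    <-> (exists2 i, i \in A & 0 < w i).
  split=> [[_ [i iA <-]]|[i iA wi]]; first by rewrite lep1mP -lt0n; exists i.
  by exists U_(i)%MM; [exists i | rewrite lep1mP -lt0n].
rewrite var_idealE; split=> [eqI w|cP].
  rewrite -varE -mon_idealXP -eqI /colon /= -mpolyXD mon_idealXP.
  by [].
apply/predeqP => f; rewrite /colon /= !mon_idealP; split=> H m.
  move=> mf; apply/varE/cP; have /H : (m + u)%MM \in msupp (f * 'X_[u])%R.
    by rewrite (perm_mem (msuppMX _ _)) addmC map_f.
  by [].
rewrite (perm_mem (msuppMX _ _)) => /mapP [m' /H /varE/cP [v sv le] ->].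
by exists v => //; rewrite addmC.
Qed.

(** * Minimal monomials and minimal generating sets *)

Definition minimal_mon I u : Prop :=
  I 'X_[u]%R /\ forall v, I 'X_[v]%R -> (v <= u)%MM -> v = u.

Lemma minimal_mon_exists I m : I 'X_[m]%R ->
  exists2 u, minimal_mon I u & (u <= m)%MM.
Proof.
have [d] := ubnP (mdeg m); elim: d m => // d IHd m; rewrite ltnS => le_md Im.
have [mM|/not_andP[//|/existsNP[v /not_implyP[Iv /not_implyP[vm neq]]]]] :=
  pselect (minimal_mon I m); first by exists m => //; exact: lepm_refl.
have [|u uM uv] := IHd v _ Iv; last by exists u => //; exact: lepm_trans vm.
rewrite (leq_trans _ le_md) // ltnNge; apply/negP => /(lepm_mdeg_eq vm); exact: neq.
Qed.

(** A generator with a proper divisor in [I] is redundant, because another generator divides it.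
    Conversely, a generating subset [V] contains a divisor of each minimal monomial, which by
    minimality is that monomial itself. *)
Lemma is_mingensP I U : is_monomial_ideal I ->
  is_mingens I U <-> (forall u, U u <-> minimal_mon I u).
Proof.
move=> [W eqW]; split=> [[eqU minU] u|HU].
  have IX m : I 'X_[m]%R <-> exists2 u, U u & (u <= m)%MM by rewrite eqU mon_idealXP.
  split=> [Uu|[/IX[v Uv vu] /(_ v) <-//]]; last by apply/IX; exists v => //; exact: lepm_refl.
  split=> [|v /IX[v' Uv' v'v] vu]; first by apply/IX; exists u => //; exact: lepm_refl.
  apply: contrapT => neq; have v'u : (v' <= u)%MM by exact: lepm_trans vu.
  have neq' : v' <> u.
    by move=> E; apply/neq/lepm_mdeg_eq => //; rewrite -E; exact: lepm_mdeg.
  (* Deleting [u] leaves a generating set, since multiples of [u] are multiples of [v']. *)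
  suff E : [set x | U x /\ x <> u]%classic = U by move: Uu; rewrite -E => -[].
  apply: minU => [x []//|]; rewrite eqU; apply: eq_mon_ideal => m; split.
    move=> [x Ux xm]; have [E|] := pselect (x = u); last by exists x.
    by exists v' => //; rewrite E in xm; exact: lepm_trans xm.
  by move=> [x [Ux _] xm]; exists x.
have IX m : I 'X_[m]%R <-> exists2 u, W u & (u <= m)%MM by rewrite eqW mon_idealXP.
split.
  rewrite eqW; apply: eq_mon_ideal => m; rewrite -IX; split=> [|[u /HU[/IX[w Ww wu] _] um]].
    by move/minimal_mon_exists => [u /HU Uu um]; exists u.
  by apply/IX; exists w => //; exact: lepm_trans um.
move=> V VU eqV; apply/predeqP => u; split=> [/VU//|/HU[+ minu]].
rewrite {1}eqV mon_idealXP => -[v Vv vu].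
by rewrite -(minu v) //; have /VU/HU[] := Vv.
Qed.

Lemma mon_ideal_monomial U : is_monomial_ideal (mon_ideal (K := K) U).
Proof. by exists U. Qed.

Lemma monomial_idealP I (f : {mpoly K[n]}) : is_monomial_ideal I ->
  I f <-> forall m, m \in msupp f -> I 'X_[m]%R.
Proof.
by move=> [U ->]; rewrite mon_idealP; split=> H m /H; rewrite mon_idealXP.
Qed.

Lemma monomial_ideal_up I u v : is_monomial_ideal I ->
  I 'X_[u]%R -> (u <= v)%MM -> I 'X_[v]%R.
Proof.
move=> [U ->] /mon_idealXP [w Uw wu] uv; apply/mon_idealXP.
by exists w => //; exact: lepm_trans uv.
Qed.

(** Divisibility between monomials of equal degree is equality, so no generator is redundant. *)
Lemma mingens_equidegree d U V : (forall u, U u -> mdeg u = d) ->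
  is_mingens (mon_ideal (K := K) U) V -> V = U.
Proof.
move=> degU /(is_mingensP _ (mon_ideal_monomial U)) HV.
apply/predeqP => u; rewrite HV; split=> [[/mon_idealXP[v Uv vu] minu]|Uu].
  by rewrite -(minu v) //; apply/mon_idealXP; exists v => //; exact: lepm_refl.
split=> [|v /mon_idealXP[w Uw wv] vu].
  by apply/mon_idealXP; exists u => //; exact: lepm_refl.
by apply: lepm_mdeg_eq => //; rewrite (degU u) // -(degU w) //; exact: lepm_mdeg.
Qed.

(** * Generators of components and of their products with the maximal ideal *)

Lemma componentE I d : is_monomial_ideal I ->
  component I d = mon_ideal (K := K) [set u | I 'X_[u]%R /\ mdeg u = d]%classic.
Proof.
move=> monI; apply/seteqP; split; apply: ideal_gen_sub; do ?exact: ideal_gen_ideal.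
  move=> f [/(monomial_idealP _ monI) If /dhomogP homf]; apply/mon_idealP => m mf.
  by exists m; [split; [exact: If | exact: homf] | exact: lepm_refl].
move=> _ [u [Iu degu] <-]; apply: sub_ideal_gen; split => //.
by apply/dhomogP => m; rewrite msuppX inE => /eqP ->.
Qed.

Lemma mon_ideal_mul U V : ideal_mul (mon_ideal (K := K) U) (mon_ideal (K := K) V) =
  mon_ideal (K := K) [set m | exists u v, [/\ U u, V v & m = (u + v)%MM]]%classic.
Proof.
apply/seteqP; split; apply: ideal_gen_sub; do ?exact: ideal_gen_ideal.
  move=> _ [f [g [/mon_idealP Hf /mon_idealP Hg ->]]]; apply/mon_idealP => m.
  move=> /msuppM_le/allpairsP [[m1 m2] /= [/Hf[u Uu um1] /Hg[v Vv vm2] ->]].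
  exists (u + v)%MM; first by exists u, v.
  by apply/mnm_lepP => i; rewrite !mnmDE leq_add // (mnm_lepP _) .
move=> _ [_ [u [v [Uu Vv ->]]] <-]; apply: sub_ideal_gen.
exists 'X_[u]%R, 'X_[v]%R; rewrite mpolyXD; split=> //; apply/mon_idealXP.
  by exists u => //; exact: lepm_refl.
by exists v => //; exact: lepm_refl.
Qed.

Lemma mingens_component I d U : is_monomial_ideal I ->
  is_mingens (component I d) U -> U = [set u | I 'X_[u]%R /\ mdeg u = d]%classic.
Proof.
move=> monI; rewrite componentE // => HU.
by apply: (mingens_equidegree (d := d) _ HU) => u [].
Qed.

Lemma mingens_max_component I d U : is_monomial_ideal I ->
  is_mingens (ideal_mul (max_ideal K n) (component I d)) U ->
  U = [set u | exists i v, [/\ I 'X_[v]%R, mdeg v = d & u = (U_(i) + v)%MM]]%classic.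
Proof.
move=> monI; rewrite componentE // /max_ideal var_idealE mon_ideal_mul => HU.
rewrite (mingens_equidegree (d := d.+1) _ HU) => [|_ [_ [v [[i _ <-] [_ dv] ->]]]].
  apply/predeqP => u; split=> [[_ [v [[i _ <-] [Iv dv] ->]]]|[i [v [Iv dv ->]]]].
    by exists i, v.
  by exists U_(i)%MM, v; split=> //; exists i => //=; rewrite inE.
by rewrite mdegD mdeg1 dv.
Qed.


(** * Admissible orders in terms of exponents *)

Lemma admissible_orderP I s : is_monomial_ideal I ->
  admissible_order I s <->
  [/\ uniq s, forall u, u \in s <-> minimal_mon I u
    & forall k, k < size s -> exists A, var_colon (take k s) (nth 0%MM s k) A].
Proof.
move=> monI; split=> -[uniq_s gens_s colon_s]; split=> //.
- by move=> u; rewrite -((is_mingensP [set u | u \in s]%classic monI).1 gens_s u).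
- case=> [|k] lt_k; last by have [A /colon_var_idealP] := colon_s k.+1 lt_k; exists A.
  (* The index 0 can be included: the empty prefix gives the zero colon ideal, generated by no
     variables. *)
  exists finset.set0 => w; rewrite take0.
  by split=> [[v]|[i]]; rewrite inE.
- exact/is_mingensP.
- by move=> k /andP[_ /colon_s[A HA]]; exists A; apply/colon_var_idealP.
Qed.

(** * Dickson's lemma and the bound on generator degrees *)

Lemma nat_monotone_subseq (f : nat -> nat) :
  exists2 phi : nat -> nat, {homo phi : k l / k < l} &
    {homo (f \o phi) : k l / k <= l}.
Proof.
(* [p N] is an index at which [f] attains its minimum over all indices from [N] on; iterating [p]
   past the previous index gives the subsequence. *)
have /choice[p Hp] N : exists k, N <= k /\ forall l, N <= l -> f k <= f l.
  have : exists x, `[< exists2 k, N <= k & f k = x >].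
    by exists (f N); apply/asboolP; exists N.
  case/ex_minnP => _ /asboolP[k Nk <-] mink; exists k; split=> // l Nl.
  by apply: mink; apply/asboolP; exists l.
pose phi := fix phi k := if k is k'.+1 then p (phi k').+1 else p 0.
have phiS k : phi k < phi k.+1 by have [] := Hp (phi k).+1.
exists phi; first exact: (homo_ltn ltn_trans phiS).
apply: (homo_leq (leqnn) leq_trans) => -[|k] /=.
  by apply: (Hp 0).2.
by apply: (Hp _).2; exact: leq_trans (phiS k) (ltnW (phiS k.+1)).
Qed.

(* Dickson's lemma *)
Lemma mnm_monotone_subseq (f : nat -> 'X_{1..n}) :
  exists2 phi : nat -> nat, {homo phi : k l / k < l} &
    forall k l, k <= l -> (f (phi k) <= f (phi l))%MM.
Proof.
suff [phi ltphi lephi] : exists2 phi : nat -> nat, {homo phi : k l / k < l} &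
    forall i, i \in enum 'I_n -> forall k l, k <= l -> f (phi k) i <= f (phi l) i.
  exists phi => // k l kl; apply/mnm_lepP => i.
  by apply: lephi => //; rewrite mem_enum.
(* Refine one coordinate at a time; coordinates already monotone stay so along a subsequence. *)
elim: (enum 'I_n) => [|i r [phi ltphi lephi]]; first by exists id.
have [psi ltpsi lepsi] := nat_monotone_subseq (fun k => f (phi k) i).
exists (phi \o psi) => [k l kl|j]; first exact/ltphi/ltpsi.
rewrite inE => /predU1P[->|jr] k l kl; first exact: lepsi.
by apply: (lephi j jr); exact: (ltnW_homo ltpsi).
Qed.

(** Minimal monomials of unbounded degree would contain a chain for divisibility. Minimality makes
    its members equal, while their degrees exceed any bound. *)
Lemma minimal_mon_bounded I : exists D, forall u, minimal_mon I u -> mdeg u < D.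
Proof.
apply: contrapT => unbounded.
have /choice[f Hf] k : exists u, minimal_mon I u /\ k <= mdeg u.
  apply: contrapT => nex; apply: unbounded; exists k => u uM.
  by rewrite ltnNge; apply/negP => ku; apply: nex; exists u.
have [phi ltphi lephi] := mnm_monotone_subseq f.
have phi_ge k : k <= phi k.
  by elim: k => // k /leq_ltn_trans; apply; exact: ltphi.
pose d := (mdeg (f (phi 0))).+1.
have [[_ minfd] le_d] := Hf (phi d); have [[If0 _] _] := Hf (phi 0).
have := leq_trans (phi_ge d) le_d.
by rewrite -(minfd _ If0 (lephi _ _ (leq0n d))) ltnn.
Qed.

(** * Concatenating the new generators of all degrees *)

Section Concatenation.
Variables (I : set {mpoly K[n]}) (sigma1 sigma2 : nat -> seq 'X_{1..n}).
Hypothesis I_mon : is_monomial_ideal I.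
Let sigma d := sigma1 d ++ sigma2 d.
Hypothesis sigma_uniq : forall d, uniq (sigma d).
Hypothesis mem_sigma : forall d u, u \in sigma d <-> I 'X_[u]%R /\ mdeg u = d.
Hypothesis sigma_colon : forall d k, k < size (sigma d) ->
  exists A, var_colon (take k (sigma d)) (nth 0%MM (sigma d) k) A.
(** The degree of [v] is forced to be [d - 1]; for [d = 0] this makes [sigma1 d] empty. *)
Hypothesis mem_sigma1 : forall d u,
  u \in sigma1 d <-> mdeg u = d /\ exists i v, I 'X_[v]%R /\ u = (U_(i) + v)%MM.

Lemma mem_sigma1_proper d u v :
  I 'X_[v]%R -> (v <= u)%MM -> v <> u -> mdeg u = d -> u \in sigma1 d.
Proof.
move=> Iv vu neq du; apply/mem_sigma1; split=> //.
have [i [w [-> vw]]] := lepm_proper vu neq.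
by exists i, w; split=> //; exact: monomial_ideal_up vw.
Qed.

(** A non-minimal monomial of degree [d] in [I] lies in [sigma1 d], which is disjoint from
    [sigma2 d]; a member of [sigma1 d] has a proper divisor in [I]. *)
Lemma mem_sigma2 d u : u \in sigma2 d <-> minimal_mon I u /\ mdeg u = d.
Proof.
split=> [u2|[[Iu minu] du]].
  have [Iu du] : I 'X_[u]%R /\ mdeg u = d by apply/mem_sigma; rewrite mem_cat u2 orbT.
  split=> //; split=> // v Iv vu; apply: contrapT => neq.
  have u1 := mem_sigma1_proper Iv vu neq du.
  have := sigma_uniq d; rewrite cat_uniq => /and3P[_ /hasPn/(_ u u2)].
  by rewrite /= u1.
have /mem_sigma : I 'X_[u]%R /\ mdeg u = d by [].
rewrite mem_cat => /orP[/mem_sigma1[_ [i [v [Iv uE]]]]|//].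
have := minu v Iv; rewrite uE => /(_ (lem_addl _ _))/(congr1 (fun m => mdeg m)).
by rewrite mdegD mdeg1 => /eqP; rewrite -[X in X == _]add0n eqn_add2r.
Qed.

(** Climb from [u] to [m] one variable at a time: the degree grows by one, so it hits [d], and the
    monomial reached there is a variable times an element of [I]. *)
Lemma between_degree d u m : I 'X_[u]%R -> (u <= m)%MM -> mdeg u < d <= mdeg m ->
  exists2 v, v \in sigma1 d & (v <= m)%MM.
Proof.
move=> Iu um /andP[lt_ud le_dm].
elim: (d - mdeg u) {-2}u (erefl (d - mdeg u)) Iu um lt_ud => [v|e IHe v].
  by move/eqP; rewrite subn_eq0 leqNgt => /negPf->.
move=> eE Iv vm vd; have [|i [w [mE vw]]] := lepm_proper vm.
  by move=> vE; move: vd; rewrite vE ltnNge le_dm.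
have wm : (U_(i) + v <= m)%MM.
  by rewrite mE; apply/mnm_lepP => j; rewrite !mnmDE leq_add2l (mnm_lepP vw).
have Iiv : I 'X_[U_(i) + v]%R by exact: monomial_ideal_up (lem_addl _ _).
have degE : mdeg (U_(i) + v)%MM = (mdeg v).+1 by rewrite mdegD mdeg1.
have [ivd|] := eqVneq (mdeg v).+1 d.
  exists (U_(i) + v)%MM => //; apply/mem_sigma1.
  by split; [rewrite degE | exists i, v].
move=> neq; apply: (IHe (U_(i) + v)%MM) => //; first by rewrite degE subnS eE.
by rewrite degE ltn_neqAle neq.
Qed.

(** The part of G(I) in degrees below [D], sorted by degree and within a degree as in [sigma2]. *)
Definition gens_lt D := flatten [seq sigma2 d | d <- iota 0 D].

Lemma gens_ltS D : gens_lt D.+1 = gens_lt D ++ sigma2 D.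
Proof. by rewrite /gens_lt -addn1 iotaD map_cat flatten_cat /= cats0. Qed.

Lemma mem_gens_lt D u : u \in gens_lt D <-> minimal_mon I u /\ mdeg u < D.
Proof.
elim: D => [|D IHD]; first by rewrite ltn0; split=> // -[].
rewrite gens_ltS mem_cat ltnS leq_eqVlt.
split=> [/orP[/IHD[uM ->]|/mem_sigma2[uM ->]]|[uM /predU1P[uD|uD]]].
- by rewrite orbT.
- by rewrite eqxx.
- by apply/orP; right; apply/mem_sigma2.
- by apply/orP; left; apply/IHD.
Qed.

Lemma gens_lt_uniq D : uniq (gens_lt D).
Proof.
elim: D => // D IHD; rewrite gens_ltS cat_uniq IHD.
have := sigma_uniq D; rewrite cat_uniq => /and3P[_ _ ->]; rewrite andbT.
apply/hasPn => u /mem_sigma2[_ uD]; apply/negP => /mem_gens_lt[_].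
by rewrite uD ltnn.
Qed.

Lemma gens_lt_colon D k : k < size (gens_lt D) ->
  exists A, var_colon (take k (gens_lt D)) (nth 0%MM (gens_lt D) k) A.
Proof.
elim: D k => // D IHD k; rewrite gens_ltS size_cat nth_cat take_cat.
case: (ltnP k (size (gens_lt D))) => [lt_k _|le_k]; first exact: IHD.
rewrite -{1}(subnKC le_k) ltn_add2l.
move: (k - size (gens_lt D)) => {le_k}k lt_k.
(* Position [k] of the last block is position [size (sigma1 D) + k] of [sigma D]; the same set of
   variables serves for both prefixes. *)
have [|A colonA] := @sigma_colon D (size (sigma1 D) + k).
  by rewrite size_cat ltn_add2l.
exists A => w; rewrite -colonA /sigma nth_cat take_cat ltnNge leq_addr /= addKn.
have [_ uD] : minimal_mon I (nth 0%MM (sigma2 D) k) /\ mdeg (nth 0%MM (sigma2 D) k) = D.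
  by apply/mem_sigma2; rewrite mem_nth.
split=> -[v]; rewrite mem_cat => /orP[v1|v2] vw.
(* A generator of degree below [D] dividing [w + u], of degree at least [D], can be raised to an
   element of [sigma1 D]. *)
- have [[Iv _] vD] := (mem_gens_lt D v).1 v1.
  have [|t t1 tw] := between_degree (d := D) Iv vw.
    by rewrite vD mdegD uD leq_addl.
  by exists t => //; rewrite mem_cat t1.
- by exists v => //; rewrite mem_cat v2 orbT.
(* Conversely, removing the variable from [v] leaves a monomial of [I] of degree below [D], and any
   minimal divisor of it precedes the block. *)
- have [dv [i [t [It vE]]]] := (mem_sigma1 D v).1 v1.
  have [x xM xt] := minimal_mon_exists It.
  exists x; last by apply: lepm_trans xt (lepm_trans _ vw); rewrite vE lem_addl.
  rewrite mem_cat; apply/orP; left; apply/mem_gens_lt; split=> //.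
  by rewrite -dv vE mdegD mdeg1 add1n ltnS lepm_mdeg.
- by exists v => //; rewrite mem_cat v2 orbT.
Qed.

Lemma concatenation_linear_quotients : has_linear_quotients I.
Proof.
have [D HD] := minimal_mon_bounded I.
exists (gens_lt D); apply/admissible_orderP => //; split.
- exact: gens_lt_uniq.
- by move=> u; rewrite mem_gens_lt; split=> [[]//|uM]; split=> //; exact: HD.
- exact: gens_lt_colon.
Qed.

End Concatenation.

End MonomialIdealTheory.

Theorem proposition2p9 (K : fieldType) (n : nat) (I : set {mpoly K[n]})
  (I_mon : is_monomial_ideal I)
  (I_clq : componentwise_linear_quotients I)
  (I_init : forall a : nat, exists s : seq 'X_{1..n},
     admissible_order (component I a) s /\
     (* I_<-1> is the zero ideal, so there is no condition for a = 0 *)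
     (forall b : nat, a = b.+1 ->
        initial_mingens (ideal_mul (max_ideal K n) (component I b)) s)) :
  has_linear_quotients I.
Proof.
(* Cut the admissible order of each component after the generators of [m I_<d-1>] and restate its
   properties on exponents. *)
have /choice[sigma Hsigma] d : exists s : seq 'X_{1..n} * seq 'X_{1..n},
    [/\ uniq (s.1 ++ s.2),
        forall u, u \in s.1 ++ s.2 <-> I 'X_[u]%R /\ mdeg u = d,
        forall k, k < size (s.1 ++ s.2) ->
          exists A, var_colon (take k (s.1 ++ s.2)) (nth 0%MM (s.1 ++ s.2) k) A
      & forall u, u \in s.1 <->
          mdeg u = d /\ exists i v, I 'X_[v]%R /\ u = (U_(i) + v)%MM].
  have [s [s_adm s_init]] := I_init d.
  have monId : is_monomial_ideal (component I d).
    by rewrite componentE //; exact: mon_ideal_monomial.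
  have [uniq_s _ colon_s] := (admissible_orderP s monId).1 s_adm.
  have [_ /(mingens_component I_mon) gens_s _] := s_adm.
  have mem_s u : u \in s <-> I 'X_[u]%R /\ mdeg u = d.
    exact: ((predeqP _ _).1 gens_s u).
  case: d => [|d] in s_init {s_adm monId gens_s} mem_s *.
    (* In degree 0 the initial part is empty, as no multiple of a variable has degree 0. *)
    exists ([::], s); split=> //= u; split=> // -[+ [i [v [_ uE]]]].
    by rewrite uE mdegD mdeg1.
  have [s1 [s2 [sE /(mingens_max_component I_mon) gens_s1]]] := s_init d erefl.
  exists (s1, s2); rewrite /= -sE; split=> // u.
  apply: (iff_trans ((predeqP _ _).1 gens_s1 u)).
  split=> [[i [v [Iv dv ->]]]|[du [i [v [Iv uE]]]]].
    by rewrite mdegD mdeg1 dv; split=> //; exists i, v.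
  by exists i, v; split=> //; move: du; rewrite uE mdegD mdeg1 => -[].
apply: (concatenation_linear_quotients (sigma1 := fun d => (sigma d).1)
  (sigma2 := fun d => (sigma d).2)) => // d; have [] := Hsigma d => //.
Qed.
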